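(* Let $(X,\cdot)$ be a group and let $(X,\mathbb{C})$ be a stratified $L$-convex space. Then $(X,\cdot,\mathbb{C})$ is a stratified $L$-convex group if and only if the mapping $k:(X\times X,\mathbb{C}\times\mathbb{C})\to(X,\mathbb{C})$, $(x,y)\mapsto xy^{-1}$, is an LCP.
   Context: Throughout, $L=(L,\le,\top,\bot,\wedge,\vee,{}')$ is a completely distributive De Morgan algebra (a completely distributive complete lattice with greatest element $\top$, least element $\bot$, and an order-reversing involution $'$). $L^X$ is the set of maps $X\to L$ with pointwise order and operations; $\hat a\in L^X$ is the constant map with value $a\in L$. A stratified $L$-convex structure on $X$ is a family $\mathbb{C}\subseteq L^X$ such that $\hat a\in\mathbb{C}$ for all $a\in L$, $\mathbb{C}$ is closed under arbitrary pointwise infima, and $\mathbb{C}$ is closed under pointwise suprema of directed subfamilies; $(X,\mathbb{C})$ is then a stratified $L$-convex space. A map $f:(X,\mathbb{C})\to(Y,\mathbb{G})$ is an LCP ($L$-convexity-preserving map) if $f^{\leftarrow}(A)=A\circ f\in\mathbb{C}$ for all $A\in\mathbb{G}$. For $A,B\in L^X$, $A\times B\in L^{X\times X}$ is $(x_1,x_2)\mapsto A(x_1)\wedge B(x_2)$. The product structure $\mathbb{C}\times\mathbb{C}$ on $X\times X$ is the initial (smallest) stratified $L$-convex structure making both projections LCPs; it equals $\{C_1\times C_2\mid C_1,C_2\in\mathbb{C}\}$. A stratified $L$-convex group $(X,\cdot,\mathbb{C})$ is a group $(X,\cdot)$ with a stratified $L$-convex structure $\mathbb{C}$ on $X$ such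 that multiplication $(X\times X,\mathbb{C}\times\mathbb{C})\to(X,\mathbb{C})$ and inversion $(X,\mathbb{C})\to(X,\mathbb{C})$ are LCPs. *)

(* Defs.v *)
From HB Require Import structures.
From mathcomp Require Import all_boot all_order.
From mathcomp Require Import boolp classical_sets.

Set Implicit Arguments.
Unset Strict Implicit.
Unset Printing Implicit Defensive.

Import Order.TTheory.

Local Open Scope classical_set_scope.
Local Open Scope order_scope.

(* [supremum] and [infimum] are only meaningful on sets that have a least upper
   (greatest lower) bound; the default value makes them correct on [set0]. *)
Definition bigsup d (L : tbLatticeType d) (A : set L) : L := supremum \bot A.
Definition biginf d (L : tbLatticeType d) (A : set L) : L := infimum \top A.

HB.mixin Record TBLattice_isCompletelyDistributive d L
    of Order.TBLattice d L := {
  supremums_neq0 : forall A : set L, supremums A !=set0;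
  infimums_neq0 : forall A : set L, infimums A !=set0;
  biginf_bigsup_distr :
    forall (I : Type) (J : I -> Type) (a : forall i, J i -> L),
      biginf (range (fun i => bigsup (range (a i)))) =
      bigsup (range (fun f : forall i, J i =>
        biginf (range (fun i => a i (f i)))))
}.

#[short(type="cdLatticeType")]
HB.structure Definition CDLattice d :=
  {L of TBLattice_isCompletelyDistributive d L & Order.TBLattice d L}.

HB.mixin Record CDLattice_isDeMorgan d L of CDLattice d L := {
  dmcompl : L -> L;
  dmcomplK : involutive dmcompl;
  le_dmcompl : forall a b : L, a <= b -> dmcompl b <= dmcompl a
}.

#[short(type="cdDeMorganType")]
HB.structure Definition CDDeMorgan d :=
  {L of CDLattice_isDeMorgan d L & CDLattice d L}.

Section LConvex.
Context d (L : cdDeMorganType d).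

Definition pw_bigsup (X : Type) (F : set (X -> L)) : X -> L :=
  fun x => bigsup [set A x | A in F].
Definition pw_biginf (X : Type) (F : set (X -> L)) : X -> L :=
  fun x => biginf [set A x | A in F].

(* The order on [X -> L] is the pointwise one of [boolp] (see [lefP]). *)
Definition directed (X : Type) (F : set (X -> L)) : Prop :=
  F !=set0 /\
  forall A B, F A -> F B -> exists C, [/\ F C, A <= C & B <= C].

Record stratified_convex (X : Type) (C : set (X -> L)) : Prop := {
  convex_cst : forall a : L, C (fun=> a);
  convex_biginf : forall F : set (X -> L), F `<=` C -> C (pw_biginf F);
  convex_bigsup : forall F : set (X -> L),
    F `<=` C -> directed F -> C (pw_bigsup F)
}.

Definition LCP (X Y : Type) (C : set (X -> L)) (G : set (Y -> L))
    (f : X -> Y) : Prop :=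
  forall A : Y -> L, G A -> C (A \o f).

(* The smallest stratified L-convex structure for which both projections are
   LCPs, obtained as the intersection of all of them. *)
Definition prod_convex (X Y : Type) (C : set (X -> L)) (G : set (Y -> L)) :
    set (X * Y -> L) :=
  \bigcap_(D in [set D | [/\ stratified_convex D, LCP D C fst & LCP D G snd]])
    D.

Lemma prod_convexP (X Y : Type) (C : set (X -> L)) (G : set (Y -> L)) :
  stratified_convex (prod_convex C G).
Proof.
split.
- by move=> a D [cD _ _]; exact: convex_cst.
- move=> F FC D hD; have [cD _ _] := hD.
  by apply: convex_biginf => // A /FC; exact.
- move=> F FC dF D hD; have [cD _ _] := hD.
  by apply: convex_bigsup => // A /FC; exact.
Qed.

Lemma prod_convex_fst (X Y : Type) (C : set (X -> L)) (G : set (Y -> L)) :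
  LCP (prod_convex C G) C fst.
Proof. by move=> A CA D [_ hfst _]; exact: hfst. Qed.

Lemma prod_convex_snd (X Y : Type) (C : set (X -> L)) (G : set (Y -> L)) :
  LCP (prod_convex C G) G snd.
Proof. by move=> A GA D [_ _ hsnd]; exact: hsnd. Qed.

Lemma prod_convex_min (X Y : Type) (C : set (X -> L)) (G : set (Y -> L))
    (D : set (X * Y -> L)) :
  stratified_convex D -> LCP D C fst -> LCP D G snd -> prod_convex C G `<=` D.
Proof. by move=> cD hfst hsnd A; apply. Qed.

Record stratified_convex_group (X : groupType) (C : set (X -> L)) : Prop := {
  convex_group_convex : stratified_convex C;
  convex_group_mul : LCP (prod_convex C C) C (fun p : X * X => (p.1 * p.2)%g);
  convex_group_inv : LCP C C (fun x : X => x^-1%g)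
}.

End LConvex.

(* Main.v *)
Require Import Defs.
From mathcomp Require Import all_boot all_order.
From mathcomp Require Import boolp classical_sets.

(** For any map [f] and stratified convex structure [C] on its domain, the [A]
    with [A \o f] in [C] form a stratified convex structure on its codomain,
    since precomposition commutes with pointwise suprema and infima.  Hence the product structure has
    the universal property of a product: a map into it is an LCP as soon as its
    two components are ([LCP_pair]).  Constant maps are LCPs because the
    structures are stratified, so the equivalence reduces to writing each map
    in terms of the others: [x * y^-1] is multiplication after inverting the
    second component, [x^-1 = 1 * x^-1], and [x * y = x * (y^-1)^-1]. *)

Section LCPTheory.
Set Implicit Arguments.
Unset Strict Implicit.
Unset Printing Implicit Defensive.

Local Open Scope classical_set_scope.
Local Open Scope order_scope.

Context {d : Order.disp_t} {L : cdDeMorganType d}.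

Lemma image_comp_eval (X Y : Type) (f : X -> Y) (F : set (Y -> L)) (x : X) :
  [set B x | B in [set A \o f | A in F]] = [set A (f x) | A in F].
Proof. by rewrite image_comp. Qed.

Lemma pw_biginf_comp (X Y : Type) (f : X -> Y) (F : set (Y -> L)) :
  pw_biginf F \o f = pw_biginf [set A \o f | A in F].
Proof. by apply/funext => x; rewrite /pw_biginf image_comp_eval. Qed.

Lemma pw_bigsup_comp (X Y : Type) (f : X -> Y) (F : set (Y -> L)) :
  pw_bigsup F \o f = pw_bigsup [set A \o f | A in F].
Proof. by apply/funext => x; rewrite /pw_bigsup image_comp_eval. Qed.

Lemma directed_comp (X Y : Type) (f : X -> Y) (F : set (Y -> L)) :
  directed F -> directed [set A \o f | A in F].
Proof.
move=> [[A0 FA0] dF]; split; first by exists (A0 \o f), A0.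
move=> _ _ [A FA <-] [B FB <-]; have [M [FM /lefP AM /lefP BM]] := dF A B FA FB.
by exists (M \o f); split; [exists M | apply/lefP => x; exact: AM
                                     | apply/lefP => x; exact: BM].
Qed.

(** The final structure: the largest one on [Y] making [f] an LCP. *)
Lemma stratified_convex_final (X Y : Type) (C : set (X -> L)) (f : X -> Y) :
  stratified_convex C -> stratified_convex [set A : Y -> L | C (A \o f)].
Proof.
move=> cC; split => /=.
- by move=> a; exact: (convex_cst cC a).
- move=> F FC; rewrite pw_biginf_comp.
  by apply: (convex_biginf cC) => _ [A /FC CA <-].
- move=> F FC dF; rewrite pw_bigsup_comp.
  apply: (convex_bigsup cC); last exact: directed_comp.
  by move=> _ [A /FC CA <-].
Qed.

Lemma LCP_cst (X Y : Type) (C : set (X -> L)) (G : set (Y -> L)) (y : Y) :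
  stratified_convex C -> LCP C G (fun=> y).
Proof. by move=> cC A _; exact: (convex_cst cC (A y)). Qed.

Lemma LCP_comp (X Y Z : Type) (C : set (X -> L)) (G : set (Y -> L))
    (H : set (Z -> L)) (f : X -> Y) (g : Y -> Z) :
  LCP C G f -> LCP G H g -> LCP C H (g \o f).
Proof. by move=> hf hg A /hg /hf. Qed.

Lemma LCP_pair (X Y Z : Type) (C : set (X -> L)) (G : set (Y -> L))
    (H : set (Z -> L)) (f : X -> Y) (g : X -> Z) :
  stratified_convex C -> LCP C G f -> LCP C H g ->
  LCP C (prod_convex G H) (fun x => (f x, g x)).
Proof.
move=> cC hf hg A.
have cD := stratified_convex_final (fun x => (f x, g x)) cC.
exact: (prod_convex_min cD hf hg).
Qed.

End LCPTheory.

Theorem proposition4p10 (d : Order.disp_t) (L : cdDeMorganType d)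
    (X : groupType) (C : set (X -> L)) (hC : stratified_convex C) :
  stratified_convex_group C <->
  LCP (prod_convex C C) C (fun p : X * X => (p.1 * p.2^-1)%g).
Proof.
have cP := prod_convexP C C.
have h1 := @prod_convex_fst _ _ _ _ C C.
have h2 := @prod_convex_snd _ _ _ _ C C.
split=> [[_ hmul hinv]|hk].
  exact: LCP_comp (LCP_pair cP h1 (LCP_comp h2 hinv)) hmul.
have hinv : LCP C C (fun x : X => x^-1%g).
  have -> : (fun x : X => x^-1%g) =
      (fun p : X * X => (p.1 * p.2^-1)%g) \o (fun x => (1%g, x)).
    by apply/funext => x /=; rewrite mul1g.
  apply: LCP_comp hk; apply: LCP_pair => //; exact: LCP_cst.
split=> //.
have -> : (fun p : X * X => (p.1 * p.2)%g) =
    (fun p : X * X => (p.1 * p.2^-1)%g) \o (fun p => (p.1, p.2^-1%g)).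
  by apply/funext => p /=; rewrite invgK.
apply: LCP_comp hk; apply: LCP_pair => //; exact: LCP_comp h2 hinv.
Qed.
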